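(* Let $D$ be the standard $4$-fold rotationally symmetric alternating $8$-crossing diagram of the knot $8_{18}$, i.e. the planar diagram which is the closure around a point of the $3$-braid $(\sigma_1\sigma_2^{-1})^4$, in which the four crossings between the two outermost strand positions are positive and the four crossings between the two innermost strand positions are negative. Then the monodromy group of $\mathcal{H}^{i,j}(D)$ is non-trivial, i.e. it contains an automorphism of $\mathcal{H}(D)=\bigoplus_{i,j}\mathcal{H}^{i,j}(D)$ different from $\mathrm{id}$ and $-\mathrm{id}$.
   Context: **Monodromy group.** The monodromy group of a link diagram $D$ is the subgroup of the automorphism group of $\mathcal{H}(D)$ consisting of the isomorphisms induced from sequences of Reidemeister moves and planar isotopies from $D$ to itself. It is called trivial if it consists of only the identity map and its negative. The homology $\mathcal{H}(D)$ and the induced maps are defined as follows. **States.** Let $D$ be an oriented link diagram in the plane with set of crossings $I$ and writhe $w(D)$. A marker at a crossing is a choice of a pair of vertical (opposite) angles there. It is positive if the chosen angles are those swept out by the overcrossing line when it is turned counterclockwise toward the undercrossing line, negative otherwise. A choice of markers at all crossings gives a resolution: a collection of disjoint embedded circles in the plane, obtained by replacing a small neighbourhood of each crossing by two parallel arcs lying in the two unmarked angles (so the two marked angles get joined). A state $S$ is a choice of markers together with a sign $+$ or $-$ on each circle of the resolution. Let $\sigma(S)$ be the sum of the signs of the markers and $\tau(S)$ the sum of the signs of the circles, and put $$i(S)=\tfrac{w(D)-\sigma(S)}2,\qquad j(S)=-\tfrac{\sigma(S)+2\tau(S)-3w(D)}2 .$$ **Chain complex.** For a finite set $L$, let $E(L)$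 be the free abelian group on the bijections $f:\{1,\dots,|L|\}\to L$ (orderings of $L$) modulo $f=(-1)^{p(f,g)}g$, where $p(f,g)$ is the parity of $f^{-1}g$. $[x]$ is the class of an ordered sequence $x$, and $xa$ is $x$ with $a$ appended at the end. $C^{i,j}(D)=\bigoplus_{L\subset I}C^{i,j}_L(D)\otimes E(L)$, where $C^{i,j}_L(D)$ is the free abelian group on states with $i(S)=i$, $j(S)=j$ whose set of negatively marked crossings is $L$. Surgery maps: a surgery along an arc merging two circles into one, or splitting one circle into two, acts on sign labellings by $m$ or $\Delta$ respectively, where $m(+\otimes+)=0$, $m(+\otimes-)=m(-\otimes+)=+$, $m(-\otimes-)=-$, $\Delta(+)=+\otimes+$, $\Delta(-)=+\otimes-\,+\,-\otimes+$, with the labels of the other circles unchanged. The differential is $d(S\otimes[x])=\sum_a d_a(S)\otimes[xa]$, over positively marked crossings $a$ of $S$, where $d_a$ changes the marker at $a$ to a negative one and applies the corresponding surgery map to the resolution. It has bidegree $(1,0)$ and $d^2=0$. $\mathcal{H}^{i,j}(D)$ is the homology of $(C^{*,j}(D),d)$. **Maps induced by planar isotopies and Reidemeister moves.** Outside the disc where the move takes place (the changing disc), markers, and signs of circles not meeting it, are unchanged. States of two diagrams with isotopic resolutions are identified. ''Small circle'' means a circle of the resolution contained in the changing disc. *Planar isotopy:* the canonical isomorphism tracing each state through the isotopy. *First Reidemeister move $\Omega_1$.* $D'$ has one more crossing $a$ than $D$. For a state $y$ of $D$, $y^{\pm}$ denotes the state of $D'$ whose resolution is that of $y$ together with a small circle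 of sign $\pm$. $Xy$ is the result of changing the sign of the circle of $y$ through the changing disc from $-$ to $+$, and $Xy=0$ if that sign is $+$. - Negative twist ($a$ a negative crossing; the negative marker at $a$ splits off the small circle): $C(D')=C'\oplus C'_{contr}$, with $C'$ spanned by the $y^-\otimes[xa]$, $C'_{contr}$ spanned by the states with positive marker at $a$ and their differentials, and $\psi:C'\to C(D)$, $\psi(y^-\otimes[xa])=(-1)^{i}y\otimes[x]$, $i=i(y)$. - Positive twist (the positive marker at $a$ splits off the small circle): $C'$ spanned by the $(y^+-(Xy)^-)\otimes[x]$, $C'_{contr}$ spanned by the states with negative marker at $a$ and the states with positive marker at $a$ whose small circle has sign $-$, and $\psi((y^+-(Xy)^-)\otimes[x])=y\otimes[x]$. *Second Reidemeister move $\Omega_2$.* $D'$ has two more crossings $a,b$ than $D$, named so that a negative marker at $a$ and a positive one at $b$ gives the resolution of $D$; then a positive marker at $a$ and a negative one at $b$ gives a resolution with a small circle, and removing the small circle gives the resolution with both markers negative (or both positive). For a state $y$ of $D$ let $y_{-+}$ be the corresponding state of $D'$, and $(s(y),-)_{+-}$ the chain with markers $+$ at $a$, $-$ at $b$, small circle signed $-$, and other signs given by the surgery map $s$ from the resolution of $D$ to the resolution with both markers negative. $C(D')=C'\oplus C'_{contr}$, where $C'$ is spanned by the $y_{-+}\otimes[xa]+(s(y),-)_{+-}\otimes[xb]$; $C'_{contr}$ is spanned by the states with markers $++$ at $a,b$, the differentials of these, the states with markers $+-$ and small circle signed $-$, and the states with markers $--$; $\psi\big(y_{-+}\otimes[xa]+(s(y),-)_{+-}\otimes[xb]\big)=(-1)^{i}y\otimes[x]$,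 $i=i(y)$. For $\Omega_1$ and $\Omega_2$, the move from $D'$ to $D$ induces $\Psi:C(D')\xrightarrow{pr_1}C'\xrightarrow{\psi}C(D)$, and the move from $D$ to $D'$ induces $\Phi:C(D)\xrightarrow{\psi^{-1}}C'\subset C(D')$. *Third Reidemeister move $\Omega_3$.* Three strands, bottom $B$, middle $M$, top $T$, form a triangle. Let $c$ be the crossing of $T$ and $M$. The move passes $B$ across $c$. The move is of type $\Omega_3$ if the positive marker at $c$ produces a bigon between $B$ and one of the two resulting arcs; otherwise it is of the mirror type $\overline{\Omega}_3$. For type $\Omega_3$: in the source $D$ let $a,b$ be the crossings of $B$ with $T,M$, named so that (with $c$ positive) a negative marker at $a$ and a positive one at $b$ gives no small circle; then markers $(+,-,+)$ at $(a,b,c)$ give a small circle. The diagrams obtained from $D$ and the target $D'$ by resolving $c$ with a negative marker are planar isotopic inside the disc; let $a',b'$ be the crossings of $D'$ corresponding to $a,b$ under this isotopy, and $c'$ the crossing of $T$ and $M$ in $D'$. Then in $D'$ markers $(-,+,+)$ at $(a',b',c')$ give a small circle, and markers $(+,-,+)$ give a resolution isotopic to that of markers $(-,+,+)$ at $(a,b,c)$ in $D$. $C(D)=C\oplus C_{contr}$, where $C$ is spanned by all states with negative marker at $c$ and all $y_{-++}\otimes[xa]+(s(y),-)_{+-+}\otimes[xb]$ (indices are markers at $a,b,c$; $s$ is the surgery map to the resolution with markers $(-,-,+)$; the small circle is signed $-$), and $C_{contr}$ is spanned by the states with markers $(+,+,+)$, the states with a small circle signed $-$ and markers $(+,-,+)$,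 and the differentials of all these. Likewise $C(D')=C'\oplus C'_{contr}$ with $C'$ spanned by all states with negative marker at $c'$ and all $y_{+-+}\otimes[xb']+(s(y),-)_{-++}\otimes[xa']$ (indices at $a',b',c'$), and $C'_{contr}$ spanned by the states with markers $(+,+,+)$, those with markers $(-,+,+)$ and small circle signed $-$, and the differentials of all these. The isomorphism $\psi:C\to C'$ is given by $$y_{-++}\otimes[xa]+(s(y),-)_{+-+}\otimes[xb]\ \mapsto\ y_{+-+}\otimes[xb']+(s(y),-)_{-++}\otimes[xa'],$$ and on states with negative marker at $c$ by the planar isotopy (with $a,b,c$ replaced by $a',b',c'$ in the $E$-factor). The move induces $C(D)\xrightarrow{pr_1}C\xrightarrow{\psi}C'\subset C(D')$. *Move $\overline\Omega_3$:* its map is the composition of the maps of the following moves: an $\Omega_2$-move between $T$ and $M$ in the wedge between them on the far side of $B$ from their crossing $c$, creating crossings $c_1,c_2$ ($c_1$ nearer to $B$); the $\Omega_3$-move passing $B$ across $c_1$; the $\Omega_2$-move removing $c$ and $c_1$. All these chain maps are chain equivalences and hence induce isomorphisms on homology; a sequence of moves induces the composition. *)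

(* Defs.v *)
From HB Require Import structures.
From mathcomp Require Import all_boot all_order all_algebra.
From mathcomp Require Import fingroup perm generic_quotient ring_quotient.
From mathcomp Require Import boolp.

Set Implicit Arguments.
Unset Strict Implicit.
Unset Printing Implicit Defensive.

Import GRing.Theory.

Local Open Scope ring_scope.
Local Open Scope quotient_scope.

(* An oriented link diagram in the plane, up to planar isotopy, as a signed    *)
(* plane 4-valent graph.  The booleans of [xin], [xout] select the strand      *)
(* ([true] = overcrossing line); [xin c l] and [xout c l] are the edges along  *)
(* which that strand enters and leaves [c].  An edge that is not incident to   *)
(* any crossing is a component without crossings.  [xsign c = true] means that *)
(* [c] is positive.  [reg e true], [reg e false] are the regions of the plane  *)
(* to the left and to the right of the oriented edge [e], [outer] is the       *)
(* unbounded one.                                                              *)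
(*                                                                             *)
(* Draw a crossing with both strands pointing up.  The strand from bottom left *)
(* to top right is the overcrossing line iff the crossing is positive, so it   *)
(* is the strand [xsign c]; [corners] lists the regions in the top, left,      *)
(* bottom and right angles.  The region labels come from an embedding in the   *)
(* plane iff the dual graph is connected and Euler's formula                   *)
(* V - E + F = 1 + (number of connected components) holds; here E = 2V, each   *)
(* component without crossings contributing nothing to V - E.                  *)
Record diagram := Diagram {
  crossing : finType;
  edge : finType;
  region : finType;
  xsign : crossing -> bool;
  xin : crossing -> bool -> edge;
  xout : crossing -> bool -> edge;
  reg : edge -> bool -> region;
  outer : region;
  xin_inj : injective (fun k : crossing * bool => xin k.1 k.2);
  xout_inj : injective (fun k : crossing * bool => xout k.1 k.2);
  xin_xout : codom (fun k : crossing * bool => xin k.1 k.2)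
             =i codom (fun k : crossing * bool => xout k.1 k.2);
  corners : forall c, let p := xsign c in
    [/\ reg (xout c p) true = reg (xout c (~~ p)) false,
        reg (xout c (~~ p)) true = reg (xin c p) true,
        reg (xin c p) false = reg (xin c (~~ p)) true &
        reg (xin c (~~ p)) false = reg (xout c p) false];
  dual_connected : forall r r', connect
    [rel u v | [exists e, exists s, (reg e s == u) && (reg e (~~ s) == v)]] r r';
  euler : #|region| =
    (#|crossing| + n_comp [rel e e' | [exists c,
        (e \in [:: xin c true; xin c false; xout c true; xout c false]) &&
        (e' \in [:: xin c true; xin c false; xout c true; xout c false])]] predT
     + 1)%N
}.

Arguments outer : clear implicits.

Section States.

Variable D : diagram.
Implicit Types (c a : crossing D) (e : edge D).

(* Markers and signs are booleans, [true] being positive.  Turning the         *)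
(* overcrossing line counterclockwise sweeps out the top and bottom angles of  *)
(* a positive crossing (both strands pointing up) and the left and right       *)
(* angles of a negative one; so the resolution respects the orientation iff    *)
(* the marker is equal to the sign of the crossing.  [arcs c mu] lists the two *)
(* arcs which replace [c], as the pairs of edges which they join.              *)
Definition arcs c (mu : bool) : seq (edge D * edge D) :=
  if mu == xsign c
  then [:: (xin c true, xout c false); (xout c true, xin c false)]
  else [:: (xin c true, xin c false); (xout c true, xout c false)].

Definition joined c mu e e' := ((e, e') \in arcs c mu) || ((e', e) \in arcs c mu).

(* The circles of a resolution are the classes of [same_circle]; a sign on     *)
(* each circle is a function on edges which is constant along the arcs.        *)
Definition adjacent (m : {ffun crossing D -> bool}) : rel (edge D) :=
  [rel e e' | [exists c, joined c (m c) e e']].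

Definition same_circle m : rel (edge D) := connect (adjacent m).

Definition state_pred (S : {ffun crossing D -> bool} * {ffun edge D -> bool}) :=
  [forall e, forall e', adjacent S.1 e e' ==> (S.2 e == S.2 e')].

Record state := State { state_val : _; _ : state_pred state_val }.

HB.instance Definition _ := [isSub for state_val].
HB.instance Definition _ := [Finite of state by <:].

Definition marks (S : state) := (val S).1.
Definition mark (S : state) c : bool := (val S).1 c.
Definition sgn (S : state) e : bool := (val S).2 e.
Definition neg (S : state) : {set crossing D} := [set c | ~~ mark S c].

Definition pm (b : bool) : int := if b then 1 else -1.
Definition writhe : int := \sum_(c : crossing D) pm (xsign c).
Definition sigma (S : state) : int := \sum_(c : crossing D) pm (mark S c).
Definition ideg (S : state) : int := ((writhe - sigma S) %/ 2)%Z.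

(* Supports of the maps m and Delta: all their coefficients are 0 or 1.        *)
Definition merges (p q r : bool) : bool :=
  (p, q, r) \in [:: (true, false, true); (false, true, true); (false, false, false)].
Definition splits (p q r : bool) : bool :=
  (p, q, r) \in [:: (true, true, true); (false, true, false); (false, false, true)].

(* [surgery a S S'] says that S' occurs in d_a(S), necessarily with            *)
(* coefficient 1.  In every resolution the two arcs replacing [a] end on       *)
(* [xin a true] and on [xout a true], respectively.                            *)
Definition surgery a (S S' : state) : bool :=
  let e1 := xin a true in
  let e2 := xout a true in
  [&& mark S a, [forall c, mark S' c == (mark S c && (c != a))],
      [forall e, [|| same_circle (marks S) e1 e, same_circle (marks S) e2 e
                   | sgn S' e == sgn S e]]
    & if same_circle (marks S) e1 e2
      then splits (sgn S e1) (sgn S' e1) (sgn S' e2)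
      else merges (sgn S e1) (sgn S e2) (sgn S' e1)].

End States.

Section Span.

Variables (V : zmodType) (P : V -> Prop).

Inductive span : V -> Prop :=
| span0 : span 0
| span_gen v : P v -> span v
| spanB v w : span v -> span w -> span (v - w).

Definition spanp : {pred V} := fun v => `[< span v >].

Lemma spanp_closed : zmod_closed spanp.
Proof.
split; first by apply/asboolP; exact: span0.
by move=> v w /asboolP sv /asboolP sw; apply/asboolP; exact: spanB.
Qed.

HB.instance Definition _ := GRing.isZmodClosed.Build V spanp spanp_closed.

End Span.

Section Chains.

Variable D : diagram.
Implicit Types (S : state D) (x : seq (crossing D)).

(* Pairs of a state and an ordering of its set of negatively marked crossings. *)
Definition generator := {S : state D &
  {x : #|neg S|.-tuple (crossing D) | uniq x && ([set c in x] == neg S)}}.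

Definition free := {ffun generator -> int}.

HB.instance Definition _ := GRing.Zmodule.on free.

(* The basis vector (S, x), or 0 if x is not an ordering of [neg S].           *)
Definition basis S x : free :=
  [ffun g : generator => ((tag g == S) && (sval (tagged g) == x :> seq _))%:R].

Inductive reordering : free -> Prop :=
| Reordering S n (x : n.-tuple (crossing D)) (p : 'S_n) :
    reordering (basis S x - basis S [tuple tnth x (p i) | i < n] *~ (-1) ^+ p).

(* C(D), that is the sum of the C_L(D) (x) E(L).                               *)
Definition chain := Quotient.quot (spanp reordering).

HB.instance Definition _ := GRing.Zmodule.on chain.
HB.instance Definition _ := EqQuotient.on chain.

(* S (x) [x], or 0 if x is not an ordering of [neg S].                         *)
Definition tensor S x : chain := \pi_chain (basis S x).

Definition dgen S x : free :=
  \sum_(a | mark S a) \sum_(S' | surgery a S S') basis S' (rcons x a).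

Definition dfree (c : free) : free :=
  \sum_(g : generator) dgen (tag g) (sval (tagged g)) *~ c g.

Definition d (c : chain) : chain := \pi_chain (dfree (repr c)).

Lemma dfree_additive : zmod_morphism dfree.
Proof.
move=> u v; rewrite /dfree -sumrB; apply: eq_bigr => g _.
by rewrite !ffunE mulrzBr.
Qed.

HB.instance Definition _ := GRing.isZmodMorphism.Build free free dfree dfree_additive.

Lemma basis_eq0 S x : ~~ (uniq x && ([set c in x] == neg S)) -> basis S x = 0.
Proof.
move=> nx; apply/ffunP => -[T [y /= hy]]; rewrite !ffunE /=.
case: eqP => //= eqTS; case: eqP => //= eqyx.
by move: nx; rewrite -eqyx -eqTS hy.
Qed.

Lemma surgery_neg a S S' : surgery a S S' -> neg S' = a |: neg S.
Proof.
case/and4P=> _ /forallP mS' _ _; apply/setP => c.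
by rewrite !inE (eqP (mS' c)) negb_and negbK orbC.
Qed.

Lemma dfree_basis S x : dfree (basis S x) = dgen S x.
Proof.
case: (boolP (uniq x && ([set c in x] == neg S))) => [ox | nx].
  have /eqP sx : size x == #|neg S|.
    by case/andP: ox => /card_uniqP <- /eqP <-; rewrite cardsE.
  move: (ox); rewrite -[x]/(val (Tuple (introT eqP sx))) => ox'.
  pose g : generator := Tagged _ (exist (fun y : #|neg S|.-tuple (crossing D) => 
     uniq y && ([set c in y] == neg S)) (Tuple (introT eqP sx)) ox').
  rewrite /dfree (bigD1 g) //= ffunE /= !eqxx mulr1z big1 ?addr0 // => h hg.
  rewrite ffunE; case: eqP => //= eqS; case: eqP => //= eqx.
  case/eqP: hg; rewrite /g; case: h eqS eqx => T [y hy] /= eqS; subst T.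
  move=> eqx; congr (Tagged _ _); apply: val_inj => /=; exact: val_inj.
rewrite basis_eq0 // raddf0 /dgen big1 // => a ma; rewrite big1 // => S' sS'.
apply: basis_eq0; apply: contra nx; rewrite (surgery_neg sS') rcons_uniq.
case/andP=> /andP[ax ->] /eqP eqn; apply/eqP/setP => c /=.
have := congr1 (fun A : {set _} => c \in A) eqn.
rewrite !inE mem_rcons inE; case: (eqVneq c a) => [-> |//] _.
by rewrite (negPf ax) ma.
Qed.

Lemma spanp_gen (V : zmodType) (P : V -> Prop) v : P v -> v \in spanp P.
Proof. by move=> Pv; apply/asboolP; exact: span_gen. Qed.

Lemma dfree_reordering c : c \in spanp reordering -> dfree c \in spanp reordering.
Proof.
move=> /asboolP; elim=> [|_ [S n x p]|v w _ IHv _ IHw].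
- by rewrite raddf0 rpred0.
- rewrite raddfB raddfMz /= !dfree_basis /dgen mulrz_suml -sumrB.
  apply: rpred_sum => a _; rewrite mulrz_suml -sumrB; apply: rpred_sum => S' _.
  have := Reordering S' [tuple of rcons x a] (lift_perm ord_max ord_max p).
  rewrite odd_lift_perm addbb addFb => /spanp_gen.
  set u := tval [tuple tnth _ _ | i < _]; suff -> : u =
    rcons [tuple tnth x (p i) | i < n] a :> seq _ by [].
  apply: (@eq_from_nth _ a); first by rewrite size_rcons !size_tuple.
  move=> i; rewrite size_tuple => lti.
  rewrite -[i]/(val (Ordinal lti)) -tnth_nth tnth_mktuple.
  case: (unliftP ord_max (Ordinal lti)) => [j -> | ->].
    have bj : bump n j = j by rewrite /bump leqNgt ltn_ord.
    rewrite lift_perm_lift (tnth_nth a) lift_max /= bj !nth_rcons !size_tuple.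
    rewrite !ltn_ord; have := tnth_mktuple (fun k => tnth x (p k)) j.
    by rewrite !(tnth_nth a) => ->; rewrite card_ord ltn_ord.
  by rewrite lift_perm_id (tnth_nth a) /= !nth_rcons !size_tuple card_ord ltnn eqxx.
- by rewrite raddfB rpredB.
Qed.

Lemma d_pi c : d (\pi_chain c) = \pi_chain (dfree c).
Proof.
apply/eqP; rewrite /d -Quotient.idealrBE -raddfB; apply: dfree_reordering.
by rewrite Quotient.idealrBE reprK.
Qed.

Lemma d_tensor S x :
  d (tensor S x) =
    \sum_(a | mark S a) \sum_(S' | surgery a S S') tensor S' (rcons x a).
Proof.
rewrite d_pi dfree_basis raddf_sum; apply: eq_bigr => a _.
by rewrite raddf_sum.
Qed.

Lemma d_additive : zmod_morphism d.
Proof.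
move=> u v; rewrite -[u]reprK -[v]reprK -raddfB !d_pi.
by rewrite -raddfB -raddfB.
Qed.

HB.instance Definition _ := GRing.isZmodMorphism.Build chain chain d d_additive.

Definition cyclep : {pred chain} := fun c => d c == 0.

Lemma cyclep_closed : zmod_closed cyclep.
Proof.
split; first by rewrite /in_mem /= /cyclep raddf0.
by move=> u v /eqP du /eqP dv; rewrite /in_mem /= /cyclep raddfB /= du dv subr0.
Qed.

HB.instance Definition _ := GRing.isZmodClosed.Build chain cyclep cyclep_closed.

Record cycle := Cycle { cycle_val : chain; _ : cycle_val \in cyclep }.

HB.instance Definition _ := [isSub for cycle_val].
HB.instance Definition _ := [Choice of cycle by <:].
HB.instance Definition _ := [SubChoice_isSubZmodule of cycle by <:].

Definition boundaryp : {pred cycle} := fun z => `[< exists b, val z = d b >].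

Lemma boundaryp_closed : zmod_closed boundaryp.
Proof.
split; first by apply/asboolP; exists 0; rewrite !raddf0.
move=> u v /asboolP[b ub] /asboolP[b' vb']; apply/asboolP.
by exists (b - b'); rewrite !raddfB /= ub vb'.
Qed.

HB.instance Definition _ := GRing.isZmodClosed.Build cycle boundaryp boundaryp_closed.

(* The differential has bidegree (1, 0), so this is the direct sum of the      *)
(* groups H^{i,j}(D).                                                          *)
Definition homology := Quotient.quot boundaryp.

HB.instance Definition _ := GRing.Zmodule.on homology.
HB.instance Definition _ := EqQuotient.on homology.

Definition hclass (z : cycle) : homology := \pi_homology z.

End Chains.

(* [z] agrees with [y] at the crossings outside [J] and on the edges outside   *)
(* [inn], under the correspondences [iota] of crossings and [pi] of edges.     *)
Definition agree D D' (iota : crossing D -> crossing D') (pi : edge D' -> edge D)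
    (J : {set crossing D}) (inn : {set edge D'}) (y : state D) (z : state D') :=
  [forall c, (c \in J) || (mark z (iota c) == mark y c)] &&
  [forall e, (e \in inn) || (sgn z e == sgn y (pi e))].

(* Orientation preserving homeomorphisms of the plane are isotopic to the      *)
(* identity, so planar isotopies between diagrams amount to isomorphisms of    *)
(* the plane graphs which respect all labels and the unbounded region.         *)
Record isotopy D D' (kappa : crossing D -> crossing D')
    (pi : edge D' -> edge D) (phi : region D' -> region D) : Prop := Isotopy {
  isotopy_crossing : bijective kappa;
  isotopy_edge : bijective pi;
  isotopy_region : bijective phi;
  isotopy_sign : forall c, xsign (kappa c) = xsign c;
  isotopy_in : forall c l, pi (xin (kappa c) l) = xin c l;
  isotopy_out : forall c l, pi (xout (kappa c) l) = xout c l;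
  isotopy_reg : forall e s, phi (reg e s) = reg (pi e) s;
  isotopy_outer : phi (outer D') = outer D
}.

Definition isotopy_map D D' (kappa : crossing D -> crossing D')
    (pi : edge D' -> edge D) (f : chain D -> chain D') : Prop :=
  forall y z x, agree kappa pi set0 set0 y z ->
    f (tensor y x) = tensor z (map kappa x).

(* D results from D' by a move which removes the crossings in [J].  The edges  *)
(* which follow each other along a strand through these crossings are fused to *)
(* a single edge of D.  Here [inn] consists of the edges of D' inside the      *)
(* changing disc, and [Q] is the region (a monogon or bigon) which disappears; *)
(* [iota] embeds the crossings of D and [phi] gives the region of D which      *)
(* contains the part outside the disc of a region of D' other than [Q].  By    *)
(* Euler's formula for D and D', [phi] identifies regions other than [Q] only  *)
(* in the case of a bigon, and then only the two regions opposite to [Q].      *)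
Record removal D D' (J : {set crossing D'}) (inn : {set edge D'}) (Q : region D')
    (iota : crossing D -> crossing D') (pi : edge D' -> edge D)
    (phi : region D' -> region D) : Prop := Removal {
  removal_inj : injective iota;
  removal_codom : forall c', (c' \in codom iota) = (c' \notin J);
  removal_surj : forall e, exists e', pi e' = e;
  removal_fuse : forall e1 e2, (pi e1 == pi e2) =
    connect [rel e e' | [exists c in J, exists l,
      ((xin c l == e) && (xout c l == e')) ||
      ((xout c l == e) && (xin c l == e'))]] e1 e2;
  removal_sign : forall c, xsign (iota c) = xsign c;
  removal_in : forall c l, pi (xin (iota c) l) = xin c l;
  removal_out : forall c l, pi (xout (iota c) l) = xout c l;
  removal_reg : forall e s, e \notin inn -> phi (reg e s) = reg (pi e) s;
  removal_bounded : Q != outer D';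
  removal_outer : phi (outer D') = outer D
}.

(* The maps of a move between D' and D, where psi : C' -> C(D) is given by     *)
(* psi (g y x) = sg y * (y (x) [x]) and C'_contr is spanned by [contr]; the    *)
(* sign [sg y] is 1 or -1.                                                     *)
Definition map_Psi D D' (g : state D -> seq (crossing D) -> chain D')
    (sg : state D -> int) (contr : chain D' -> Prop) (f : chain D' -> chain D) :=
  (forall y x, f (g y x) = tensor y x *~ sg y) /\ (forall c, contr c -> f c = 0).

Definition map_Phi D D' (g : state D -> seq (crossing D) -> chain D')
    (sg : state D -> int) (f : chain D -> chain D') :=
  forall y x, f (tensor y x) = g y x *~ sg y.

Section Omega1.

Variables (D D' : diagram) (a : crossing D') (e : edge D').
Variables (iota : crossing D -> crossing D') (pi : edge D' -> edge D).

(* The edge [e] is a loop at [a], and one side of it is the whole boundary of  *)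
(* the region [Q].                                                             *)
Definition kink (Q : region D') : Prop :=
  (exists l, xout a l = e /\ xin a (~~ l) = e) /\
  (exists s, forall e' s', (reg e' s' == Q) = ((e', s') == (e, s))).

Definition omega1 (phi : region D' -> region D) : Prop :=
  exists2 Q, kink Q & removal [set a] [set e] Q iota pi phi.

(* The states y1 = Xy (there is one, or none if Xy = 0).                       *)
Definition isX (y y1 : state D) : bool :=
  [&& marks y1 == marks y, ~~ sgn y (pi e) &
      [forall e', sgn y1 e' == (same_circle (marks y) (pi e) e' || sgn y e')]].

(* The (unique) state z of D' which consists of y and of a small circle of     *)
(* sign [s].  In either case the small circle is split off by the marker equal *)
(* to the sign of [a], and it consists of the edge [e].                        *)
Definition with_circle (s : bool) (y : state D) (z : state D') : bool :=
  [&& agree iota pi set0 [set e] y z, mark z a == xsign a & sgn z e == s].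

Definition omega1_gen (y : state D) (x : seq (crossing D)) : chain D' :=
  if xsign a
  then \sum_(z | with_circle true y z) tensor z (map iota x) -
       \sum_(y1 | isX y y1) \sum_(z | with_circle false y1 z) tensor z (map iota x)
  else \sum_(z | with_circle false y z) tensor z (rcons (map iota x) a).

Definition omega1_sign (y : state D) : int :=
  if xsign a then 1 else (-1) ^ ideg y.

Definition omega1_contr (c : chain D') : Prop :=
  exists z x,
    if xsign a
    then (~~ mark z a \/ mark z a /\ ~~ sgn z e) /\ c = tensor z x
    else mark z a /\ (c = tensor z x \/ c = d (tensor z x)).

End Omega1.

(* For a state [y] with negative marker at [a] and positive marker at [b],     *)
(* y (x) [xa] + (s(y), -) (x) [xb], where the surgery s(y) changes the marker  *)
(* at [b], and (s(y), -) has the opposite markers at [a] and [b] and a         *)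
(* negative small circle through [e]; [inn] are the edges inside the disc.     *)
Definition bigon_gen D (a b : crossing D) (inn : {set edge D}) (e : edge D)
    (y : state D) (x : seq (crossing D)) : chain D :=
  tensor y (rcons x a) +
  \sum_(w | surgery b y w)
    \sum_(v | [&& agree id id [set a; b] inn w v, mark v a, ~~ mark v b & ~~ sgn v e])
      tensor v (rcons x b).

(* The edge [e] joins the crossings k.1 and k'.1, along the strands k.2, k'.2. *)
Definition links D (k k' : crossing D * bool) (e : edge D) : bool :=
  ((xout k.1 k.2 == e) && (xin k'.1 k'.2 == e)) ||
  ((xout k'.1 k'.2 == e) && (xin k.1 k.2 == e)).

Section Omega2.

Variables (D D' : diagram) (a b : crossing D') (e e' : edge D').
Variables (iota : crossing D -> crossing D') (pi : edge D' -> edge D).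

(* The edges [e] (over) and [e'] (under) bound a bigon [Q]; they form a small  *)
(* circle if the marker at [a] is positive and the one at [b] is negative.     *)
Definition bigon (Q : region D') : Prop :=
  [/\ a != b, links (a, true) (b, true) e, links (a, false) (b, false) e',
      joined a true e e' /\ joined b false e e' &
      exists s s', forall u t,
        (reg u t == Q) = ((u, t) \in [:: (e, s); (e', s')])].

Definition omega2 (phi : region D' -> region D) : Prop :=
  exists2 Q, bigon Q & removal [set a; b] [set e; e'] Q iota pi phi.

Definition omega2_gen (y : state D) (x : seq (crossing D)) : chain D' :=
  \sum_(z | [&& agree iota pi set0 [set e; e'] y z, ~~ mark z a & mark z b])
    bigon_gen a b [set e; e'] e z (map iota x).

Definition omega2_sign (y : state D) : int := (-1) ^ ideg y.

Definition omega2_contr (c : chain D') : Prop :=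
  exists z x,
    [/\ mark z a, mark z b & c = tensor z x \/ c = d (tensor z x)] \/
    ((mark z a /\ ~~ mark z b /\ ~~ sgn z e) \/ (~~ mark z a /\ ~~ mark z b)) /\
    c = tensor z x.

End Omega2.

(* The move is from D to D'.  The bijection [kappa] sends the crossing of two  *)
(* strands of the triangle to the crossing of the same strands in D'.  The     *)
(* crossing [a] is the one of T and B if [h], and of M and B otherwise; [t],   *)
(* [m], [r] are the sides of the triangle of D' on T, M and B, and their       *)
(* images under [pi] are those of the triangle of D.                           *)
Section Omega3.

Variables (D D' : diagram) (a b c : crossing D) (h : bool) (t m r : edge D').
Variables (kappa : crossing D -> crossing D') (pi : edge D' -> edge D).

Let p := if h then a else b.
Let q := if h then b else a.

(* A strand runs through [k1], then [k2] in D, and in the reverse order in D'; *)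
(* [e] is its side of the triangle.                                            *)
Definition passes (k1 k2 : crossing D * bool) (e : edge D') : bool :=
  [&& xout k1.1 k1.2 == pi e, xin k2.1 k2.2 == pi e,
      xout (kappa k2.1) k2.2 == e, xin (kappa k1.1) k1.2 == e,
      pi (xin (kappa k2.1) k2.2) == xin k1.1 k1.2 &
      pi (xout (kappa k1.1) k1.2) == xout k2.1 k2.2].

Definition triangle D0 (e1 e2 e3 : edge D0) : Prop :=
  exists2 Q, Q != outer D0 & exists s1 s2 s3, forall u s,
    (reg u s == Q) = ((u, s) \in [:: (e1, s1); (e2, s2); (e3, s3)]).

Record omega3 (phi : region D' -> region D) : Prop := Omega3 {
  omega3_crossing : bijective kappa;
  omega3_edge : bijective pi;
  omega3_uniq : uniq [:: a; b; c];
  omega3_top : passes (c, true) (p, true) t || passes (p, true) (c, true) t;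
  omega3_middle : passes (c, false) (q, true) m || passes (q, true) (c, false) m;
  omega3_bottom : passes (p, false) (q, false) r || passes (q, false) (p, false) r;
  omega3_sign : forall k, xsign (kappa k) = xsign k;
  omega3_in : forall k l, k \notin [:: a; b; c] -> pi (xin (kappa k) l) = xin k l;
  omega3_out : forall k l, k \notin [:: a; b; c] -> pi (xout (kappa k) l) = xout k l;
  omega3_reg : forall e s, e \notin [:: t; m; r] -> phi (reg e s) = reg (pi e) s;
  omega3_outer : phi (outer D') = outer D;
  omega3_source : triangle (pi t) (pi m) (pi r);
  omega3_target : triangle t m r;
  (* a positive marker at c produces a bigon *)
  omega3_type : joined c true (pi t) (pi m);
  (* which becomes a small circle if the markers at a, b are +, - *)
  omega3_naming : joined p h (pi t) (pi r) /\ joined q (~~ h) (pi m) (pi r)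
}.

(* After resolving [c] with a negative marker, the crossing of B with T in D   *)
(* becomes the crossing of B with M in D' by the isotopy, and vice versa.      *)
Definition prime (k : crossing D) : crossing D' := kappa (tperm a b k).

Definition omega3_contr (u : chain D) : Prop :=
  exists z x, (u = tensor z x \/ u = d (tensor z x)) /\
    [/\ mark z a, mark z c & mark z b \/ ~~ mark z b /\ ~~ sgn z (pi r)].

Definition omega3_map (f : chain D -> chain D') : Prop :=
  [/\ forall y z x, ~~ mark y c -> agree prime pi set0 [set t; m; r] y z ->
        f (tensor y x) = tensor z (map prime x),
      forall y z x,
        [/\ ~~ mark y a, mark y b & mark y c] ->
        [/\ mark z (prime a), ~~ mark z (prime b) & mark z (prime c)] ->
        agree prime pi [set a; b; c] [set t; m; r] y z ->
        f (bigon_gen a b [set pi t; pi m; pi r] (pi r) y x) =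
        bigon_gen (prime b) (prime a) [set t; m; r] r z (map prime x) &
      forall u, omega3_contr u -> f u = 0].

End Omega3.

(* The chain maps of planar isotopies and Reidemeister moves.  The mirror type *)
(* of the third move does not occur, as its map is by definition the           *)
(* composition of the maps of a second, a third and a second move.             *)
Inductive move D D' (f : chain D -> chain D') : Prop :=
| Move_isotopy kappa pi phi of
    isotopy kappa pi phi & isotopy_map kappa pi f
| Move_omega1_Psi a e iota pi phi of
    @omega1 D' D a e iota pi phi &
    map_Psi (omega1_gen a e iota pi) (omega1_sign a) (omega1_contr a e) f
| Move_omega1_Phi a e iota pi phi of
    @omega1 D D' a e iota pi phi &
    map_Phi (omega1_gen a e iota pi) (omega1_sign a) f
| Move_omega2_Psi a b e e' iota pi phi of
    @omega2 D' D a b e e' iota pi phi &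
    map_Psi (omega2_gen a b e e' iota pi) (@omega2_sign D') (omega2_contr a b e) f
| Move_omega2_Phi a b e e' iota pi phi of
    @omega2 D D' a b e e' iota pi phi &
    map_Phi (omega2_gen a b e e' iota pi) (@omega2_sign D) f
| Move_omega3 a b c h t m r kappa pi phi of
    @omega3 D D' a b c h t m r kappa pi phi & omega3_map a b c t m r kappa pi f.

(* The homomorphisms on homology induced by sequences of moves.                *)
Inductive induced : forall D D', (homology D -> homology D') -> Prop :=
| Induced_id D : induced (@id (homology D))
| Induced_move D D' D'' (f : chain D -> chain D') (F : homology D -> homology D')
    (G : homology D' -> homology D'') of
    zmod_morphism f & move f &
    (forall z : cycle D, exists2 z' : cycle D',
       val z' = f (val z) & F (hclass z) = hclass z') &
    induced G : induced (G \o F).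

Definition monodromy_group D (g : homology D -> homology D) : Prop :=
  [/\ zmod_morphism g, bijective g & induced g].

(* The closure of the 3-braid (sigma_1 sigma_2^-1)^4, with strands running     *)
(* counterclockwise around the center.  For k in Z/4, the crossing (true, k)   *)
(* is the k-th crossing between the two outer positions and (false, k) the     *)
(* k-th one between the two inner positions, in the cyclic order               *)
(* (true, 0), (false, 0), (true, 1), (false, 1), ...  The edge (t, o, k)       *)
(* starts at the crossing (t, k), in the outer (o = true) or inner (o = false) *)
(* one of its two positions.  The regions are the outer one [inl true], the    *)
(* central one [inl false], and the ones between the outer two positions,      *)
(* [inr (true, k)], which end at the crossings (true, k) and (true, k + 1), or *)
(* between the inner two, [inr (false, k)], which end at (false, k) and        *)
(* (false, k + 1).                                                             *)
Section D8_18.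

Let I := (bool * 'Z_4)%type.
Let E := (bool * bool * 'Z_4)%type.
Let F := (bool + bool * 'Z_4)%type.

Definition xsign8_18 (c : I) : bool := c.1.

Definition xin8_18 (c : I) (over : bool) : E :=
  let: (t, k) := c in
  match t, over with
  | true, true => (false, true, k - 1)
  | true, false => (true, true, k - 1)
  | false, true => (true, false, k)
  | false, false => (false, false, k - 1)
  end.

Definition xout8_18 (c : I) (over : bool) : E :=
  let: (t, k) := c in
  match t, over with
  | true, true => (true, true, k)
  | true, false => (true, false, k)
  | false, true => (false, false, k)
  | false, false => (false, true, k)
  end.

Definition reg8_18 (e : E) (left : bool) : F :=
  let: (t, o, k) := e in
  match t, o with
  | true, true => if left then inr (true, k) else inl true
  | true, false => if left then inr (false, k - 1) else inr (true, k)
  | false, true => if left then inr (false, k) else inr (true, k)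
  | false, false => if left then inl false else inr (false, k)
  end.

Lemma xin8_18_inj : injective (fun k : I * bool => xin8_18 k.1 k.2).
Proof.
move=> [[[] k] []] [[[] k'] []] //= eqk; have /= := congr1 snd eqk.
all: try by move=> /addIr ->.
by move=> ->.
Qed.

Lemma xout8_18_inj : injective (fun k : I * bool => xout8_18 k.1 k.2).
Proof. by move=> [[[] k] []] [[[] k'] []] //= -[] ->. Qed.

Lemma xin_xout8_18 : codom (fun k : I * bool => xin8_18 k.1 k.2)
  =i codom (fun k : I * bool => xout8_18 k.1 k.2).
Proof.
move=> e; apply/idP/idP => _; apply/codomP; case: e => -[[] []] k.
- by exists ((true, k), true).
- by exists ((true, k), false).
- by exists ((false, k), false).
- by exists ((false, k), true).
- by exists ((true, k + 1), false); rewrite /= addrK.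
- by exists ((false, k), true).
- by exists ((true, k + 1), true); rewrite /= addrK.
- by exists ((false, k + 1), false); rewrite /= addrK.
Qed.

Lemma corners8_18 c : let p := xsign8_18 c in
  [/\ reg8_18 (xout8_18 c p) true = reg8_18 (xout8_18 c (~~ p)) false,
      reg8_18 (xout8_18 c (~~ p)) true = reg8_18 (xin8_18 c p) true,
      reg8_18 (xin8_18 c p) false = reg8_18 (xin8_18 c (~~ p)) true &
      reg8_18 (xin8_18 c (~~ p)) false = reg8_18 (xout8_18 c p) false].
Proof. by case: c => -[]. Qed.

Lemma dual_connected8_18 r r' : connect
  [rel u v | [exists e, exists s, (reg8_18 e s == u) && (reg8_18 e (~~ s) == v)]]
  r r'.
Proof.
set R := [rel u v | _].
have RP e s : connect R (reg8_18 e s) (reg8_18 e (~~ s)).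
  by apply: connect1; apply/existsP; exists e; apply/existsP; exists s; rewrite !eqxx.
have Rsym : connect_sym R.
  apply: sym_connect_sym => u v; apply/existsP/existsP => -[e /existsP[s /andP[es es']]].
    by exists e; apply/existsP; exists (~~ s); rewrite negbK es es'.
  by exists e; apply/existsP; exists (~~ s); rewrite negbK es es'.
suff Rl u : connect R u (inl true).
  by apply: connect_trans (Rl r) _; rewrite Rsym.
have U k : connect R (inr (true, k)) (inl true) := RP (true, true, k) true.
have V k : connect R (inr (false, k)) (inl true).
  exact: connect_trans (RP (false, true, k) true) (U k).
case: u => [[|]|[[] k]] //.
exact: connect_trans (RP (false, false, 0) true) (V 0).
Qed.

Lemma euler8_18 : #|{: F}| = (#|{: I}| + n_comp [rel e e' | [exists c,
    (e \in [:: xin8_18 c true; xin8_18 c false; xout8_18 c true; xout8_18 c false]) &&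
    (e' \in [:: xin8_18 c true; xin8_18 c false; xout8_18 c true; xout8_18 c false])]]
  predT + 1)%N.
Proof.
set R := [rel e e' | _].
have RP c e e' :
  e \in [:: xin8_18 c true; xin8_18 c false; xout8_18 c true; xout8_18 c false] ->
  e' \in [:: xin8_18 c true; xin8_18 c false; xout8_18 c true; xout8_18 c false] ->
  connect R e e'.
  by move=> ce ce'; apply: connect1; apply/existsP; exists c; rewrite ce.
have Rsym : connect_sym R.
  by apply: sym_connect_sym => u v; apply: eq_existsb => c; rewrite andbC.
have S k : connect R (true, true, k - 1) (true, true, k).
  by apply: (RP (true, k)); rewrite !inE eqxx ?orbT.
have A k : connect R (true, true, 0) (true, true, k).
  have -> : k = (k : nat)%:R by rewrite natr_Zp.
  elim: (k : nat) => // n IHn; apply: connect_trans IHn _.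
  by have := S n.+1%:R; rewrite -natr1 addrK.
have B k : connect R (true, true, 0) (true, false, k).
  by apply: connect_trans (A k) _; apply: (RP (true, k)); rewrite !inE eqxx ?orbT.
have -> : n_comp R predT = n_comp R (connect R (true, true, 0)).
  apply: eq_n_comp_r => -[[[] []] k]; rewrite !inE; symmetry; rewrite ?A ?B //.
    by apply: connect_trans (B k) _; apply: (RP (false, k)); rewrite !inE eqxx ?orbT.
  by apply: connect_trans (B k) _; apply: (RP (false, k)); rewrite !inE eqxx ?orbT.
by rewrite n_comp_connect // card_sum !card_prod !card_bool card_ord.
Qed.

Definition diagram8_18 : diagram :=
  Diagram (inl true) xin8_18_inj xout8_18_inj xin_xout8_18
    corners8_18 dual_connected8_18 euler8_18.

End D8_18.

(* Main.v *)
From HB Require Import structures.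
From mathcomp Require Import all_boot all_order all_algebra.
From mathcomp Require Import fingroup perm generic_quotient ring_quotient.
From mathcomp Require Import boolp.
Require Import Defs.

(** The automorphism is induced by the rotation of the diagram by a quarter
    turn, which is a planar isotopy from the diagram to itself.  It is detected
    in bidegree (i, j) = (-3, -7).

    The resolution with positive markers only has five circles: the outer circle
    and four circles inside it in cyclic order, numbered by Z/4.  Let its graph
    have these circles as vertices and the crossings as edges, a crossing
    joining the two circles which meet there.  It is the wheel with four spokes,
    the crossings (true, k), from circle k to the hub, and four rim edges, the
    crossings (false, k), from circle k to circle k + 1.

    In bidegree (-3, -7) a state has exactly one negative marker, and all its
    signs are +.  So there is one state per edge of the wheel.  It is a cycle:
    as no two edges of the wheel are parallel, every further surgery merges two
    circles of sign +, and m(+ (x) +) = 0 (see [plus_state_cycle]).  The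
    boundaries come from the states with positive markers and exactly one sign
    -, and the boundary of such a state is the sum of the edges at its circle of
    sign -.  Modulo 2, counting the edges which belong to a given circuit of
    the wheel therefore defines a homomorphism which vanishes on boundaries,
    since a circuit uses an even number of edges at each vertex.  Take the
    triangle formed by the hub and the circles 0 and 1 (see [parity_d]).  The
    rim edge 0 belongs to it, and its image, the rim edge 1, does not.  So the
    class of the rim edge 0 has parity 1 and its image has parity 0, while
    the identity and its negative both preserve parity.

    Homomorphisms out of the chain group, whether the chain map of the isotopy
    or the parity, are defined on tensors by a universal property ([extend]). *)

Set Implicit Arguments.
Unset Strict Implicit.
Unset Printing Implicit Defensive.

Import GRing.Theory.
Local Open Scope ring_scope.
Local Open Scope quotient_scope.

(** * Homomorphisms out of the chain group *)

Section UniversalProperty.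

Variable D : diagram.
Implicit Types (S : state D) (x : seq (crossing D)).

Definition ordering S x := uniq x && ([set c in x] == neg S).

(** The conditions under which a function of states and sequences of crossings
    factors through the tensor product with E(L). *)
Record alternating (V : zmodType) (u : state D -> seq (crossing D) -> V) : Prop :=
  Alternating {
    alternating0 : forall S x, ~~ ordering S x -> u S x = 0;
    alternating_perm : forall S n (x : n.-tuple (crossing D)) (p : 'S_n),
      u S x = u S [tuple tnth x (p i) | i < n] *~ (-1) ^+ p
  }.

Section Extend.

Variables (V : zmodType) (u : state D -> seq (crossing D) -> V).
Hypothesis ualt : alternating u.

Definition extend_free (c : free D) : V :=
  \sum_(g : generator D) u (tag g) (sval (tagged g)) *~ c g.

Lemma extend_free_additive : zmod_morphism extend_free.
Proof.
move=> v w; rewrite /extend_free -sumrB; apply: eq_bigr => g _.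
by rewrite !ffunE mulrzBr.
Qed.

HB.instance Definition _ :=
  GRing.isZmodMorphism.Build (free D) V extend_free extend_free_additive.

Lemma extend_free_basis S x : extend_free (basis S x) = u S x.
Proof.
case: (boolP (ordering S x)) => [ox | nx]; last first.
  by rewrite (alternating0 ualt nx) basis_eq0 // raddf0.
have sx : size x == #|neg S|.
  by case/andP: (ox) => /card_uniqP <- /eqP <-; rewrite cardsE.
pose g : generator D := Tagged _ (exist (fun y : #|neg S|.-tuple (crossing D) =>
   uniq y && ([set c in y] == neg S)) (Tuple sx) ox).
rewrite /extend_free (bigD1 g) //= ffunE /= !eqxx mulr1z big1 ?addr0 // => h hg.
rewrite ffunE; case: eqP => //= eqS; case: eqP => //= eqx.
case/eqP: hg; rewrite /g; case: h eqS eqx => T [y hy] /= eqS; subst T.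
by move=> eqx; congr (Tagged _ _); do 2! apply: val_inj => /=.
Qed.

Lemma extend_free_reordering c :
  c \in spanp (@reordering D) -> extend_free c = 0.
Proof.
move=> /asboolP; elim=> [|_ [S n x p]|v w _ v0 _ w0]; first exact: raddf0.
  by rewrite raddfB raddfMz /= !extend_free_basis -(alternating_perm ualt) subrr.
by rewrite raddfB /= v0 w0 subrr.
Qed.

(** The proof of alternation is an argument so that additivity can be inferred
    from the term. *)
Definition extend of alternating u := fun c : chain D => extend_free (repr c).

Lemma extend_pi c : extend ualt (\pi_(chain D) c) = extend_free c.
Proof.
apply/eqP; rewrite -subr_eq0 -raddfB; apply/eqP/extend_free_reordering.
by rewrite Quotient.idealrBE reprK.
Qed.

Lemma extend_additive : zmod_morphism (extend ualt).
Proof.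
move=> v w; rewrite -[v]reprK -[w]reprK -raddfB !extend_pi.
exact: raddfB.
Qed.

Lemma extend_tensor S x : extend ualt (tensor S x) = u S x.
Proof. by rewrite extend_pi extend_free_basis. Qed.

End Extend.

HB.instance Definition _ V u (ualt : @alternating V u) :=
  GRing.isZmodMorphism.Build (chain D) V (extend ualt) (extend_additive ualt).

Lemma tensor_not_ordering S x : ~~ ordering S x -> tensor S x = 0.
Proof. by move=> nx; rewrite /tensor basis_eq0 // raddf0. Qed.

Lemma tensor_perm S n (x : n.-tuple (crossing D)) (p : 'S_n) :
  tensor S x = tensor S [tuple tnth x (p i) | i < n] *~ (-1) ^+ p.
Proof.
apply/eqP; rewrite /tensor -raddfMz -Quotient.idealrBE.
exact/spanp_gen/Reordering.
Qed.

Lemma chain_sum (c : chain D) : exists k : generator D -> int,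
  c = \sum_(g : generator D) tensor (tag g) (sval (tagged g)) *~ k g.
Proof.
exists (repr c); rewrite -[c in LHS]reprK.
transitivity (\pi_(chain D) (\sum_(g : generator D)
    basis (tag g) (sval (tagged g)) *~ repr c g)).
  congr (\pi _); apply/ffunP => g; rewrite sum_ffunE (bigD1 g) //= big1 => [|h hg].
    by rewrite addr0 ffunMzE ffunE !eqxx /= intz.
  rewrite ffunMzE ffunE; case: eqP => [eqS|]; last by rewrite mul0rz.
  case: eqP => [eqx|]; last by rewrite mul0rz.
  case/eqP: hg; case: g h eqS eqx => S [x hx] [T [y hy]] /= eqS; subst T.
  by move=> eqx; congr (Tagged _ _); do 2! apply: val_inj => /=.
by rewrite raddf_sum; apply: eq_bigr => g _; rewrite raddfMz.
Qed.

Lemma eq_on_tensors (V : zmodType) (f g : {additive chain D -> V}) :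
  (forall S x, f (tensor S x) = g (tensor S x)) -> f =1 g.
Proof.
move=> fg c; have [k ->] := chain_sum c.
by rewrite !raddf_sum; apply: eq_bigr => h _; rewrite !raddfMz /= fg.
Qed.

End UniversalProperty.

(** * Homology maps of chain maps *)

Lemma hclass_eq D (z z' : cycle D) :
  hclass z = hclass z' <-> exists b, val z - val z' = d b.
Proof.
split=> [/eqP | [b zb]].
  by rewrite /hclass -Quotient.idealrBE => /asboolP[b zb]; exists b; rewrite -zb raddfB.
apply/eqP; rewrite /hclass -Quotient.idealrBE; apply/asboolP.
by exists b; rewrite raddfB.
Qed.

Section HomologyMap.

Variables (D D' : diagram) (f : {additive chain D -> chain D'}).
Hypothesis fd : forall c, d (f c) = f (d c).

Lemma cycle_map_subproof (z : cycle D) : f (val z) \in @cyclep D'.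
Proof. by case: z => c /= /eqP dc; rewrite unfold_in /= fd dc raddf0. Qed.

Definition cycle_map z : cycle D' := Cycle (cycle_map_subproof z).

Definition homology_map (h : homology D) : homology D' := hclass (cycle_map (repr h)).

Lemma homology_mapE z : homology_map (hclass z) = hclass (cycle_map z).
Proof.
have [b zb] : exists b, val (repr (hclass z)) - val z = d b.
  by apply/hclass_eq; rewrite /hclass reprK.
by apply/hclass_eq; exists (f b); rewrite /= -raddfB zb fd.
Qed.

Lemma homology_map_additive : zmod_morphism homology_map.
Proof.
move=> h k; rewrite -[h]reprK -[k]reprK -!/(hclass _).
have hB E (z w : cycle E) : hclass (z - w) = hclass z - hclass w by exact: raddfB.
rewrite -hB !homology_mapE -hB; congr hclass; apply: val_inj.
by rewrite /= !raddfB.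
Qed.

End HomologyMap.

Lemma homology_mapK D D' (f : {additive chain D -> chain D'})
    (g : {additive chain D' -> chain D})
    (fd : forall c, d (f c) = f (d c)) (gd : forall c, d (g c) = g (d c)) :
  cancel f g -> cancel (homology_map fd) (homology_map gd).
Proof.
move=> fK h; rewrite -[h]reprK -!/(hclass _) !homology_mapE.
by congr hclass; apply: val_inj; rewrite /= fK.
Qed.

(** * Planar isotopies *)

Lemma homo_connect (T T' : finType) (R : rel T) (R' : rel T') (h : T -> T') :
  {homo h : x y / R x y >-> R' x y} ->
  {homo h : x y / connect R x y >-> connect R' x y}.
Proof.
move=> hR x _ /connectP[p xp ->]; elim: p x xp => [|y p IHp] x /=.
  by move=> _; exact: connect0.
by case/andP=> /hR /connect1 xy /IHp; exact: connect_trans.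
Qed.

Lemma isotopy_inv D D' (kappa : crossing D -> crossing D')
    (pi : edge D' -> edge D) (phi : region D' -> region D) kappa' pi' phi' :
    cancel kappa kappa' -> cancel kappa' kappa -> cancel pi pi' ->
    cancel pi' pi -> cancel phi phi' -> cancel phi' phi ->
  isotopy kappa pi phi -> isotopy kappa' pi' phi'.
Proof.
move=> kK k'K pK p'K fK f'K [_ _ _ ks ki ko fr fo]; split.
- by exists kappa.
- by exists pi.
- by exists phi.
- by move=> c; rewrite -ks k'K.
- by move=> c l; rewrite -ki k'K pK.
- by move=> c l; rewrite -ko k'K pK.
- by move=> e s; rewrite -[e in LHS]p'K -fr fK.
- by rewrite -fo fK.
Qed.

Section Isotopy.

Variables (D D' : diagram) (kappa : crossing D -> crossing D').
Variables (pi : edge D' -> edge D) (phi : region D' -> region D).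
Variables (kappa' : crossing D' -> crossing D).
Hypotheses (iso : isotopy kappa pi phi).
Hypotheses (kappaK : cancel kappa kappa') (kappaK' : cancel kappa' kappa).

Let kappa_inj := can_inj kappaK.
Let pi_inj : injective pi := bij_inj (isotopy_edge iso).

Definition move_marks (m : {ffun crossing D -> bool}) : {ffun crossing D' -> bool} :=
  [ffun c => m (kappa' c)].

Lemma joined_isotopy c mu e e' :
  joined (kappa c) mu e e' = joined c mu (pi e) (pi e').
Proof.
pose pp (ee : edge D' * edge D') := (pi ee.1, pi ee.2).
have pp_inj : injective pp by move=> [? ?] [? ?] [] /pi_inj -> /pi_inj ->.
have -> : joined c mu (pi e) (pi e') =
    (pp (e, e') \in map pp (arcs (kappa c) mu)) ||
    (pp (e', e) \in map pp (arcs (kappa c) mu)).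
  rewrite /joined /arcs (isotopy_sign iso).
  by case: eqP => _; rewrite /= /pp /= !(isotopy_in iso) !(isotopy_out iso).
by rewrite !mem_map.
Qed.

Lemma adjacent_isotopy m e e' :
  adjacent (move_marks m) e e' = adjacent m (pi e) (pi e').
Proof.
apply/existsP/existsP => -[c]; last first.
  by exists (kappa c); rewrite ffunE kappaK joined_isotopy.
by rewrite ffunE => j; exists (kappa' c); rewrite -joined_isotopy kappaK'.
Qed.

Lemma same_circle_isotopy m e e' :
  same_circle (move_marks m) e e' = same_circle m (pi e) (pi e').
Proof.
have [pi' piK piK'] := isotopy_edge iso.
apply/idP/idP => [|ee'].
  by apply: homo_connect => u v; rewrite adjacent_isotopy.
rewrite -(piK e) -(piK e'); move: ee'.
by apply: homo_connect => u v uv; rewrite adjacent_isotopy !piK'.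
Qed.

Lemma move_state_subproof (y : state D) :
  state_pred (move_marks (marks y), [ffun e => sgn y (pi e)]).
Proof.
apply/forallP=> e; apply/forallP=> e'; apply/implyP => /=.
rewrite adjacent_isotopy !ffunE.
by have /forallP/(_ (pi e))/forallP/(_ (pi e'))/implyP := valP y.
Qed.

Definition move_state (y : state D) : state D' := State (move_state_subproof y).

Lemma mark_move_state y c : mark (move_state y) (kappa c) = mark y c.
Proof. by rewrite /mark ffunE kappaK. Qed.

Lemma sgn_move_state y e : sgn (move_state y) e = sgn y (pi e).
Proof. by rewrite /sgn ffunE. Qed.

Lemma agree_move_state y z : agree kappa pi set0 set0 y z -> z = move_state y.
Proof.
case/andP=> /forallP mz /forallP sz; apply: val_inj; rewrite [val z]surjective_pairing.
congr pair.
  apply/ffunP => c; have := mz (kappa' c).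
  by rewrite inE /mark kappaK' => /eqP ->; rewrite ffunE.
by apply/ffunP => e; have := sz e; rewrite inE ffunE => /eqP.
Qed.

Lemma neg_move_state y : neg (move_state y) = kappa @: neg y.
Proof.
apply/setP => c; rewrite -[c]kappaK' mem_imset // !inE.
by rewrite mark_move_state.
Qed.

(** Together with [move_state] being a bijection, this makes the chain map of an
    isotopy commute with the differential. *)
Lemma surgery_move_state a y z :
  surgery (kappa a) (move_state y) (move_state z) = surgery a y z.
Proof.
have [pi' piK piK'] := isotopy_edge iso.
rewrite /surgery !same_circle_isotopy !sgn_move_state mark_move_state.
rewrite (isotopy_in iso) (isotopy_out iso).
congr [&& _, _, _ & _].
  apply/forallP/forallP => mz c.
    by have := mz (kappa c); rewrite !mark_move_state (inj_eq kappa_inj).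
  by have := mz (kappa' c); rewrite -(inj_eq kappa_inj) -!mark_move_state kappaK'.
apply/forallP/forallP => sz e; last first.
  by rewrite !same_circle_isotopy (isotopy_in iso) (isotopy_out iso) !sgn_move_state.
by have := sz (pi' e);
  rewrite !same_circle_isotopy (isotopy_in iso) (isotopy_out iso) !sgn_move_state piK'.
Qed.

Lemma ordering_move_state y x :
  ordering (move_state y) (map kappa x) = ordering y x.
Proof.
rewrite /ordering (map_inj_uniq kappa_inj) neg_move_state; congr (_ && _).
have -> : [set c in map kappa x] = kappa @: [set c in x].
  by apply/setP => c; rewrite -[c]kappaK' mem_imset // !inE mem_map.
by apply/eqP/eqP => [/(imset_inj kappa_inj) | ->].
Qed.

Lemma isotopy_alternating :
  alternating (fun y x => tensor (move_state y) (map kappa x)).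
Proof.
split=> [y x nx | y n x p]; first by apply: tensor_not_ordering; rewrite ordering_move_state.
rewrite (tensor_perm _ (map_tuple kappa x) p); congr (tensor _ _ *~ _).
rewrite /= -map_comp; apply: eq_map => i /=.
by rewrite tnth_map.
Qed.

Definition isotopy_chain : chain D -> chain D' := extend isotopy_alternating.

HB.instance Definition _ := GRing.Additive.on isotopy_chain.

Lemma isotopy_chain_tensor y x :
  isotopy_chain (tensor y x) = tensor (move_state y) (map kappa x).
Proof. exact: extend_tensor. Qed.

Lemma isotopy_chainP : isotopy_map kappa pi isotopy_chain.
Proof. by move=> y z x /agree_move_state ->; rewrite isotopy_chain_tensor. Qed.

End Isotopy.

Section IsotopyInverse.

Variables (D D' : diagram) (kappa : crossing D -> crossing D').
Variables (pi : edge D' -> edge D) (phi : region D' -> region D).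
Variables (kappa' : crossing D' -> crossing D) (pi' : edge D -> edge D').
Variables (phi' : region D -> region D').
Hypotheses (iso : isotopy kappa pi phi) (iso' : isotopy kappa' pi' phi').
Hypotheses (kappaK : cancel kappa kappa') (kappaK' : cancel kappa' kappa).
Hypotheses (piK' : cancel pi' pi).

Lemma move_stateK :
  cancel (move_state iso kappaK kappaK') (move_state iso' kappaK' kappaK).
Proof.
move=> y; symmetry; apply: agree_move_state.
apply/andP; split; apply/forallP => c; apply/orP; right.
  by rewrite -{2}[c]kappaK' mark_move_state.
by rewrite sgn_move_state piK'.
Qed.

Lemma isotopy_chainK :
  cancel (isotopy_chain iso kappaK kappaK') (isotopy_chain iso' kappaK' kappaK).
Proof.
move=> c; apply: (eq_on_tensors
  (f := isotopy_chain iso' kappaK' kappaK \o isotopy_chain iso kappaK kappaK')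
  (g := idfun)) => y x /=.
by rewrite !isotopy_chain_tensor move_stateK mapK.
Qed.

End IsotopyInverse.

Lemma isotopy_chain_d D D' kappa pi phi kappa'
    (iso : @isotopy D D' kappa pi phi)
    (kappaK : cancel kappa kappa') (kappaK' : cancel kappa' kappa) c :
  d (isotopy_chain iso kappaK kappaK' c) = isotopy_chain iso kappaK kappaK' (d c).
Proof.
have [pi' piK piK'] := isotopy_edge iso.
have [phi' phiK phiK'] := isotopy_region iso.
have iso' := isotopy_inv kappaK kappaK' piK piK' phiK phiK' iso.
set f := isotopy_chain _ _ _.
apply: (eq_on_tensors (f := @d D' \o f) (g := f \o @d D)) => y x /=.
rewrite /f isotopy_chain_tensor !d_tensor raddf_sum.
rewrite (reindex kappa) /=; last by exists kappa' => ? _.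
apply: eq_big => [a|a _]; first by rewrite mark_move_state.
rewrite raddf_sum (reindex (move_state iso kappaK kappaK')) /=; last first.
  exists (move_state iso' kappaK' kappaK) => z _; first exact: move_stateK piK' z.
  exact: (move_stateK iso' iso kappaK' kappaK piK).
apply: eq_big => [z|z _]; first by rewrite surgery_move_state.
by rewrite isotopy_chain_tensor map_rcons.
Qed.

Lemma isotopy_monodromy D kappa pi phi kappa' (iso : @isotopy D D kappa pi phi)
    (kappaK : cancel kappa kappa') (kappaK' : cancel kappa' kappa) :
  monodromy_group (homology_map (isotopy_chain_d iso kappaK kappaK')).
Proof.
have [pi' piK piK'] := isotopy_edge iso.
have [phi' phiK phiK'] := isotopy_region iso.
have iso' := isotopy_inv kappaK kappaK' piK piK' phiK phiK' iso.
split.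
- exact: homology_map_additive.
- exists (homology_map (isotopy_chain_d iso' kappaK' kappaK)); apply: homology_mapK.
    exact: isotopy_chainK piK'.
  exact: isotopy_chainK piK.
- apply: (@Induced_move _ _ _ (isotopy_chain iso kappaK kappaK') _ id).
  + exact: raddfB.
  + exact/(Move_isotopy iso)/isotopy_chainP.
  + move=> z; exists (cycle_map (isotopy_chain_d iso kappaK kappaK') z) => //.
    exact: homology_mapE.
  + exact: Induced_id.
Qed.

(** * Circles and signs of states *)

Lemma joined_sym (D : diagram) (c : crossing D) mu e e' :
  joined c mu e e' = joined c mu e' e.
Proof. by rewrite /joined orbC. Qed.

Lemma same_circle_sym (D : diagram) m (e e' : edge D) :
  same_circle m e e' = same_circle m e' e.
Proof.
apply: sym_connect_sym => u v; apply: eq_existsb => c; exact: joined_sym.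
Qed.

Lemma same_circle_joined (D : diagram) (m : {ffun crossing D -> bool}) c e e' :
  joined c (m c) e e' -> same_circle m e e'.
Proof. by move=> j; apply/connect1/existsP; exists c. Qed.

Lemma same_circle_invariant (D : diagram) (m : {ffun crossing D -> bool})
    (T : eqType) (h : edge D -> T) :
    (forall c ee, ee \in arcs c (m c) -> h ee.1 = h ee.2) ->
  forall e e', same_circle m e e' -> h e = h e'.
Proof.
move=> hm e _ /connectP[p ep ->]; elim: p e ep => //= u p IHp e /andP[eu /IHp <-].
by case/existsP: eu => c /orP[] /hm.
Qed.

Lemma sgn_circle (D : diagram) (S : state D) e e' :
  same_circle (marks S) e e' -> sgn S e = sgn S e'.
Proof.
apply: same_circle_invariant => c [u v] cuv.
have /forallP/(_ u)/forallP/(_ v)/implyP := valP S.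
by move=> /(_ _)/eqP; apply; apply/existsP; exists c; rewrite /joined cuv.
Qed.

Lemma plus_state_subproof (D : diagram) (c : crossing D) :
  state_pred ([ffun a => a != c], [ffun=> true] : {ffun edge D -> bool}).
Proof.
by apply/forallP=> e; apply/forallP=> e'; rewrite !ffunE eqxx implybT.
Qed.

Definition plus_state (D : diagram) (c : crossing D) : state D :=
  State (plus_state_subproof c).

Lemma neg_plus_state (D : diagram) (c : crossing D) : neg (plus_state c) = [set c].
Proof. by apply/setP => a; rewrite !inE /mark ffunE negbK. Qed.

Lemma plus_stateP (D : diagram) (c : crossing D) (S : state D) :
  neg S = [set c] -> (forall e, sgn S e) -> S = plus_state c.
Proof.
move=> /setP nS pS; apply: val_inj; rewrite [val S]surjective_pairing.
congr pair; apply/ffunP => a; rewrite ffunE; last exact: pS.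
by have := nS a; rewrite !inE => /(congr1 negb); rewrite negbK.
Qed.

(** * The rotation of the diagram *)

Notation K := diagram8_18.

Definition rot (c : crossing K) : crossing K := (c.1, c.2 + 1).
Definition rot' (c : crossing K) : crossing K := (c.1, c.2 - 1).
Definition rot_edge (e : edge K) : edge K := (e.1, e.2 - 1).
Definition rot_region (r : region K) : region K :=
  if r is inr (b, k) then inr (b, k - 1) else r.

Lemma rotK : cancel rot rot'.
Proof. by case=> t k; rewrite /rot /rot' /= addrK. Qed.

Lemma rotK' : cancel rot' rot.
Proof. by case=> t k; rewrite /rot /rot' /= subrK. Qed.

Lemma rot_isotopy : isotopy rot rot_edge rot_region.
Proof.
split.
- by exists rot'; [exact: rotK | exact: rotK'].
- exists (fun e => (e.1, e.2 + 1)) => -[t k]; rewrite /rot_edge /=.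
    by rewrite subrK.
  by rewrite addrK.
- exists (fun r => if r is inr (b, k) then inr (b, k + 1) else r).
    by case=> [|[b k]] //=; rewrite subrK.
  by case=> [|[b k]] //=; rewrite addrK.
- by [].
- by move=> [[] k] []; rewrite /rot_edge /= ?addrK.
- by move=> [[] k] []; rewrite /rot_edge /= ?addrK.
- by move=> [[[] []] k] [].
- by [].
Qed.

(** * The wheel of the resolution with positive markers *)

Definition all_positive : {ffun crossing K -> bool} := [ffun=> true].

(** The circle of the all positive resolution through an edge: [None] is the
    outer circle, and [Some k] the circle inside it which the crossing
    (true, k) joins to the outer one. *)
Definition circle (e : edge K) : option 'Z_4 :=
  let: (t, o, k) := e in
  match t, o with
  | true, true => None
  | true, false => Some k
  | false, _ => Some (k + 1)
  end.

Definition circle_edge (u : option 'Z_4) : edge K :=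
  if u is Some k then (true, false, k) else (true, true, 0).

Lemma circle_edgeK : cancel circle_edge circle.
Proof. by case. Qed.

Lemma circle_arc c ee : ee \in arcs c true -> circle ee.1 = circle ee.2.
Proof.
by case: c => -[] k; rewrite !inE => /orP[] /eqP -> //=; rewrite subrK.
Qed.

Lemma circle_xin t k : circle (@xin K (t, k) true) = Some k.
Proof. by case: t; rewrite //= subrK. Qed.

Lemma circle_xout t k : circle (@xout K (t, k) true) = if t then None else Some (k + 1).
Proof. by case: t. Qed.

Lemma same_circle_positive e e' :
  same_circle all_positive e e' = (circle e == circle e').
Proof.
apply/idP/eqP => [|ee'].
  by apply: same_circle_invariant => c ee; rewrite ffunE; exact: circle_arc.
suff U u : same_circle all_positive (circle_edge (circle u)) u.
  apply: connect_trans (U e'); rewrite -ee' -/(same_circle _ _ _).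
  by rewrite same_circle_sym.
have J c v w : joined c true v w -> same_circle all_positive v w.
  by move=> j; apply: (@same_circle_joined _ _ c); rewrite ffunE.
have Jout k : same_circle all_positive (true, true, k - 1) (true, true, k).
  by apply: (J (true, k)); rewrite /joined !inE /= !eqxx !orbT.
case: u => -[[] []] k /=.
- have -> : k = (k : nat)%:R by rewrite natr_Zp.
  elim: (k : nat) => [|n IHn]; first exact: connect0.
  by apply: connect_trans IHn _; have := Jout n.+1%:R; rewrite -natr1 addrK.
- exact: connect0.
- by apply: (J (true, k + 1)); rewrite /joined !inE /= addrK !eqxx.
- by apply: (J (false, k + 1)); rewrite /joined !inE /= addrK !eqxx.
Qed.

(** * A parity of homology classes *)

Definition triangle : seq (crossing K) := [:: (false, 0); (true, 0); (true, 1)].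

Definition edge_parity (S : state K) (x : seq (crossing K)) : 'F_2 :=
  [&& ordering S x, x \in [seq [:: c] | c <- triangle] & [forall e, sgn S e]]%:R.

Lemma edge_parity_size S x : size x != 1 -> edge_parity S x = 0.
Proof.
rewrite /edge_parity; case: mapP => [[c _ ->] //|_ _].
by rewrite andbF.
Qed.

(** A single crossing has only one ordering, so no sign occurs where the parity
    can be nonzero. *)
Lemma edge_parity_alternating : alternating edge_parity.
Proof.
split=> [S x /negPf nx|S n x p]; first by rewrite /edge_parity nx.
case: (eqVneq n 1) => [n1|n1]; last by rewrite !edge_parity_size ?size_tuple ?mul0rz ?card_ord.
case: _ / (esym n1) x p => x p.
have -> : [tuple tnth x (p i) | i < 1] = x.
  by apply: eq_from_tnth => i; rewrite tnth_mktuple [p i]ord1 [i]ord1.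
suff -> : p = 1%g by rewrite odd_perm1.
by apply/permP => i; rewrite [p i]ord1 [i]ord1 perm1.
Qed.

Definition parity := extend edge_parity_alternating.

HB.instance Definition _ := GRing.Additive.on parity.

Lemma parity_tensor S x : parity (tensor S x) = edge_parity S x.
Proof. exact: extend_tensor. Qed.

(** Since m(+ (x) -) = + and m(+ (x) +) = 0, a surgery which merges two circles
    leads to the signs + only iff one of these circles is the only one of sign
    -. *)
Lemma surgery_plus_state (S : state K) a :
    marks S = all_positive -> circle (xin a true) != circle (xout a true) ->
  surgery a S (plus_state a) =
  (sgn S (xin a true) (+) sgn S (xout a true)) &&
  [forall e, [|| circle (xin a true) == circle e, circle (xout a true) == circle e
               | sgn S e]].
Proof.
move=> mS ne; rewrite /surgery mS !same_circle_positive (negPf ne).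
have mE c : mark S c by have := congr1 (fun m : {ffun _} => m c) mS; rewrite /mark ffunE.
rewrite mE; have -> /= : [forall c, mark (plus_state a) c == mark S c && (c != a)].
  by apply/forallP => c; rewrite mE /mark ffunE.
have pE e : sgn (plus_state a) e by rewrite /sgn ffunE.
rewrite [LHS]andbC; congr (_ && _).
  by rewrite pE /merges; case: (sgn S _); case: (sgn S _).
apply: eq_forallb => e; rewrite !same_circle_positive pE.
by case: (sgn S e).
Qed.

(** Only tensors of the empty sequence have boundary terms of one negative
    marker.  If the only circle of sign - is a vertex of the triangle, then
    exactly the two sides of the triangle at this vertex contribute; otherwise
    no side does. *)
Lemma parity_d S x : parity (d (tensor S x)) = 0.
Proof.
case: x => [|y x]; last first.
  rewrite d_tensor raddf_sum big1 // => a _; rewrite raddf_sum big1 // => S' _.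
  by rewrite /= parity_tensor edge_parity_size //= size_rcons.
case: (boolP (ordering S [::])) => [/eqP nS | nS]; last first.
  by rewrite tensor_not_ordering // !raddf0.
have mE c : mark S c by have /setP/(_ c) := nS; rewrite !inE => /esym/negbFE.
have mS : marks S = all_positive by apply/ffunP => c; rewrite ffunE; exact: mE.
rewrite d_tensor raddf_sum /=.
(* For each crossing, [plus_state a] is the only possible term of parity 1. *)
transitivity (\sum_(a <- triangle) (surgery a S (@plus_state K a))%:R : 'F_2).
  rewrite big_uniq //= big_mkcond [RHS]big_mkcond /=; apply: eq_bigr => a _.
  rewrite mE raddf_sum big_mkcond (bigD1 (@plus_state K a)) //= big1 ?addr0.
    rewrite /= parity_tensor /edge_parity /ordering neg_plus_state.
    have -> : [set c in [:: a]] = [set a] by apply/setP => c; rewrite !inE.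
    rewrite eqxx mem_map /=; last by move=> ? ? [].
    have -> : [forall e, sgn (@plus_state K a) e] by apply/forallP => e; rewrite /sgn ffunE.
    by rewrite andbT; case: (surgery _ _ _); case: (a \in _).
  move=> S' nS'; case: ifP => // _; rewrite /= parity_tensor /edge_parity.
  case: and3P => // -[/andP[_ /eqP oS'] _ /forallP pS']; case/eqP: nS'.
  by apply: plus_stateP pS'; rewrite -oS'; apply/setP => c; rewrite !inE.
(* The signs of circles, and whether all circles off the triangle have sign +. *)
pose s u := sgn S (circle_edge u).
have sE e : sgn S e = s (circle e).
  by apply: sgn_circle; rewrite mS same_circle_positive circle_edgeK.
pose rest := [forall e, (circle e \in [:: None; Some 0; Some 1]) || s (circle e)].
have restE u v w : perm_eq [:: u; v; w] [:: None; Some 0; Some 1] ->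
    [forall e, [|| u == circle e, v == circle e | sgn S e]] = s w && rest.
  move=> uvw; have memE := perm_mem uvw.
  have uw : uniq [:: u; v; w] by rewrite (perm_uniq uvw).
  apply/forallP/andP => [all_e | [sw /forallP all_e] e].
    split.
      have := all_e (circle_edge w); rewrite sE circle_edgeK.
      by move: uw; rewrite /= !inE andbT negb_or => /andP[/andP[_ /negPf ->] /negPf ->].
    apply/forallP => e; rewrite -memE !inE; have := all_e e; rewrite sE.
    by rewrite ![circle e == _]eq_sym => /or3P[] ->; rewrite ?orbT.
  have := all_e e; rewrite -memE !inE sE ![circle e == _]eq_sym -!orbA.
  by case/or4P=> [->|->|/eqP <-|->]; rewrite ?sw ?orbT.
rewrite /triangle !big_cons big_nil !surgery_plus_state ?circle_xin ?circle_xout //.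
rewrite !sE !circle_xin !circle_xout add0r addr0.
rewrite (restE _ _ None) // (restE _ _ (Some 1)) // (restE _ _ (Some 0)) //.
case: (rest); last by rewrite !andbF !addr0.
by case: (s None); case: (s (Some 0)); case: (s (Some 1)); apply/eqP.
Qed.

Lemma parity_boundary c : parity (d c) = 0.
Proof.
apply: (eq_on_tensors (f := parity \o @d K) (g := \0)) => S x /=.
exact: parity_d.
Qed.

Definition rim : crossing K := (false, 0).

(** The negative marker at [rim] merges the circles 0 and 1 and keeps the others
    apart.  As no other crossing joins these two, each further surgery merges
    two different circles, both of sign +. *)
Lemma plus_state_cycle : tensor (plus_state rim) [:: rim] \in @cyclep K.
Proof.
rewrite unfold_in /= d_tensor big1 // => a ma; rewrite big1 // => S'.
have {ma} ne : a != rim by move: ma; rewrite /mark ffunE.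
(* A numbering of the circles after the merger, which uses 0 for both. *)
pose h e := if circle e == Some 1 then Some 0 else circle e.
have hE : forall e e', same_circle (marks (plus_state rim)) e e' -> h e = h e'.
  apply: same_circle_invariant => c ee; rewrite ffunE.
  case: eqVneq => [->|_]; last by rewrite /h => /circle_arc ->.
  by rewrite !inE => /orP[] /eqP ->; apply/eqP.
case/and4P=> _ _ _; case: ifP => [/hE | _]; last by rewrite /sgn !ffunE.
case: a ne => [[] k] ne; rewrite /h circle_xin circle_xout; first by case: ifP.
by case: k ne => [[|[|[|[|]]]]].
Qed.

(** * The theorem *)

Theorem theorem1 :
  exists g : homology diagram8_18 -> homology diagram8_18,
    [/\ monodromy_group g, g <> id & g <> -%R].
Proof.
pose z := Cycle plus_state_cycle.
pose f := isotopy_chain rot_isotopy rotK rotK'.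
pose g := homology_map (isotopy_chain_d rot_isotopy rotK rotK').
have parity_z : parity (val z) = 1.
  rewrite parity_tensor /edge_parity /ordering neg_plus_state /=.
  have -> : [set c in [:: rim]] = [set rim] by apply/setP => c; rewrite !inE.
  have -> : [forall e, sgn (plus_state rim) e] by apply/forallP => e; rewrite /sgn ffunE.
  by rewrite eqxx.
have parity_fz : parity (f (val z)) = 0.
  rewrite /f isotopy_chain_tensor parity_tensor /edge_parity.
  by rewrite !inE andbF.
have parityE (w w' : cycle K) : hclass w = hclass w' -> parity (val w) = parity (val w').
  by case/hclass_eq => b wb; apply/eqP; rewrite -subr_eq0 -raddfB wb /= parity_boundary.
have gz : g (hclass z) = hclass (cycle_map (isotopy_chain_d rot_isotopy rotK rotK') z).
  exact: homology_mapE.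
exists g; split; first exact: isotopy_monodromy.
  move=> gid; move: gz; rewrite gid => /parityE.
  by rewrite parity_z [RHS]parity_fz.
move=> gN; move: gz; rewrite gN.
have -> : - hclass z = hclass (- z) by rewrite /hclass raddfN.
by move/parityE; rewrite [RHS]parity_fz raddfN /= parity_z.
Qed.
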